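(* Let $\mathit{init}$, $\mathit{env}$, $\mathit{ctrl}$, $\mathit{plant}$, $\mathit{guarantee}$ be given, over the real-valued variables $x, v, x_c, a_n, a_s, \tau$ and the real symbolic parameters $a_s^{\min}, a_n^{\min}, a_n^{\max}, T$ (never modified by the programs), by $$\mathit{guarantee} \equiv (x \ge x_c \to v = 0),$$ $$\mathit{plant} \equiv \tau := 0;\ \{x' = v,\ v' = a_s,\ \tau' = 1\ \&\ v \ge 0 \land \tau \le T\},$$ $$\mathit{ctrl} \equiv \text{if } (x_c - x \ge \mathrm{msd}(T))\ \ a_s := a_n\ \ \text{else}\ \ a_s := -a_s^{\min},$$ $$\mathrm{msd}(T) \equiv \begin{cases} vT + \dfrac{a_n T^2}{2} + \dfrac{(v + a_n T)^2}{2 a_s^{\min}} & \text{if } v + a_n T \ge 0,\\[2mm] -\dfrac{v^2}{2 a_n} & \text{otherwise,}\end{cases} \qquad \mathrm{msd}(0) \equiv \frac{v^2}{2 a_s^{\min}},$$ $$\mathit{env} \equiv x_c := *;\ ?(x_c - x \ge \mathrm{msd}(0));\ a_n := *;\ ?(-a_n^{\min} \le a_n \le a_n^{\max}),$$ $$\mathit{init} \equiv a_s^{\min} > 0 \land a_n^{\max} > 0 \land a_n^{\min} > 0 \land T > 0 \land v \ge 0 \land x_c - x \ge \mathrm{msd}(0).$$ Then the differential dynamic logic formula $$\mathit{init} \to [(\mathit{env};\ \mathit{ctrl};\ \mathit{plant})^*]\,\mathit{guarantee}$$ is valid; that is, for every state satisfying $\mathit{init}$, every state reachable from it by executing the hybrid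 program $(\mathit{env};\mathit{ctrl};\mathit{plant})^*$ satisfies $\mathit{guarantee}$.
   Context: Interpretation: a vehicle has position $x$ and velocity $v$; $x_c$ is a critical position supplied by the environment (the critical velocity being $0$); $a_n$ is the nominal requested acceleration; $a_s$ is the acceleration issued by the safety controller; $T$ is the maximal sampling time; $a_n^{\min}, a_n^{\max}, a_s^{\min}$ are positive acceleration/braking bounds. Hybrid programs and semantics. A state is a map from variables to $\mathbb{R}$. Each hybrid program $\alpha$ denotes a reachability relation $\rho(\alpha)$ on states: - $y := e$: the value of $y$ becomes the current value of the term $e$, all other variables unchanged. - $y := *$: the value of $y$ becomes an arbitrary real number, all other variables unchanged. - $?P$: relates a state to itself if $P$ holds there; otherwise the run aborts (no successor state). - $\{y' = f(y)\ \&\ Q\}$: relates $s$ to $s'$ if for some duration $d \ge 0$ there is a solution of the differential equation system on $[0,d]$ starting at $s$, ending at $s'$, such that $Q$ holds at all times in $[0,d]$; variables not in the system are unchanged. - $\alpha;\beta$: sequential composition. $\alpha \cup \beta$: nondeterministic choice (union of relations). - $\text{if }(P)\ \alpha\ \text{else}\ \beta$ abbreviates $(?P;\alpha)\cup(?\neg P;\beta)$. - $\alpha^*$: $\alpha$ repeated any finite number $n \ge 0$ of times (reflexive transitive closure). The formula $[\alpha]\phi$ holds in $s$ iff $\phi$ holds in every $s'$ with $(s,s')\in\rho(\alpha)$. A formula is valid if it holds in all states. The expressions $\mathrm{msd}(T)$ and $\mathrm{msd}(0)$ are always evaluated with the current values of the variables occurring in them. *)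

(* Defs.v *)
(* Stdlib world: classical real numbers. *)
From Stdlib Require Import Reals List Relations.
Import ListNotations.
Open Scope R_scope.

(* Vx, Vv, Vxc, Van, Vas, Vtau stand for x, v, x_c, a_n, a_s, tau;
   Pasmin, Panmin, Panmax, PT stand for the symbolic parameters
   a_s^min, a_n^min, a_n^max, T. *)
Inductive var : Set :=
  | Vx | Vv | Vxc | Van | Vas | Vtau
  | Pasmin | Panmin | Panmax | PT.

Definition var_eq_dec (y z : var) : {y = z} + {y <> z}.
Proof. decide equality. Defined.

Definition state : Type := var -> R.

(* Terms and formulas are represented by their denotations. *)
Definition term : Type := state -> R.
Definition formula : Type := state -> Prop.

Definition upd (s : state) (y : var) (r : R) : state :=
  fun z => if var_eq_dec z y then r else s z.

Inductive hp : Type :=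
  | Assign : var -> term -> hp
  | AssignAny : var -> hp
  | Test : formula -> hp
  | ODE : list (var * term) -> formula -> hp
  | Seq : hp -> hp -> hp
  | Choice : hp -> hp -> hp
  | Star : hp -> hp.

Definition Ite (P : formula) (a b : hp) : hp :=
  Choice (Seq (Test P) a) (Seq (Test (fun s => ~ P s)) b).

(* [phi] is only constrained on [0, d]. The derivative is taken relative to
   that interval ([D_in]), so it is one-sided at the endpoints and imposes
   nothing when d = 0. *)
Definition solution (sys : list (var * term)) (Q : formula)
    (d : R) (phi : R -> state) : Prop :=
  (forall y e, In (y, e) sys -> forall t, 0 <= t <= d ->
     D_in (fun u => phi u y) (fun u => e (phi u)) (fun u => 0 <= u <= d) t) /\
  (forall y, ~ In y (map fst sys) -> forall t, 0 <= t <= d ->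
     phi t y = phi 0 y) /\
  (forall t, 0 <= t <= d -> Q (phi t)).

Fixpoint rho (a : hp) : relation state :=
  match a with
  | Assign y e => fun s s' => s' = upd s y (e s)
  | AssignAny y => fun s s' => exists r : R, s' = upd s y r
  | Test P => fun s s' => s' = s /\ P s
  | ODE sys Q => fun s s' =>
      exists (d : R) (phi : R -> state),
        0 <= d /\ solution sys Q d phi /\ phi 0 = s /\ phi d = s'
  | Seq b c => fun s s' => exists s'', rho b s s'' /\ rho c s'' s'
  | Choice b c => fun s s' => rho b s s' \/ rho c s s'
  | Star b => clos_refl_trans state (rho b)
  end.

Definition Box (a : hp) (P : formula) : formula :=
  fun s => forall s', rho a s s' -> P s'.

Definition Imp (P Q : formula) : formula := fun s => P s -> Q s.

Definition valid (P : formula) : Prop := forall s, P s.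

(* In the second case, v >= 0 and T > 0 force a_n < 0, so Stdlib's convention
   for division by zero plays no role where [msd_T] is used. *)
Definition msd_T : term := fun s =>
  if Rle_dec 0 (s Vv + s Van * s PT) then
    s Vv * s PT + s Van * s PT ^ 2 / 2
    + (s Vv + s Van * s PT) ^ 2 / (2 * s Pasmin)
  else - (s Vv ^ 2 / (2 * s Van)).

Definition msd_0 : term := fun s => s Vv ^ 2 / (2 * s Pasmin).

Definition init : formula := fun s =>
  s Pasmin > 0 /\ s Panmax > 0 /\ s Panmin > 0 /\ s PT > 0 /\
  s Vv >= 0 /\ s Vxc - s Vx >= msd_0 s.

Definition env : hp :=
  Seq (AssignAny Vxc)
  (Seq (Test (fun s => s Vxc - s Vx >= msd_0 s))
  (Seq (AssignAny Van)
       (Test (fun s => - s Panmin <= s Van <= s Panmax)))).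

Definition ctrl : hp :=
  Ite (fun s => s Vxc - s Vx >= msd_T s)
      (Assign Vas (fun s => s Van))
      (Assign Vas (fun s => - s Pasmin)).

Definition plant : hp :=
  Seq (Assign Vtau (fun _ => 0))
      (ODE [(Vx, fun s => s Vv); (Vv, fun s => s Vas); (Vtau, fun _ => 1)]
           (fun s => s Vv >= 0 /\ s Vtau <= s PT)).

Definition guarantee : formula := fun s => s Vx >= s Vxc -> s Vv = 0.

(* Main.v *)
(** Besides [a_s^min > 0], the loop invariant is [v >= 0] and
    [x_c - x >= v^2 / (2 a_s^min)].  During the plant [x] and [v] follow the
    explicit parabola, for which [2 a (x(t) - x(0)) = v(t)^2 - v(0)^2].  The
    distance travelled plus the braking distance then changes at the rate
    [v(t) (1 + a / a_s^min)], so it is monotone in [t]: if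
    [a <= - a_s^min] it is bounded by its initial value [msd(0)], otherwise by
    its value at time [T] or at the stopping time, which is [msd(T)]. *)
From Stdlib Require Import Reals Lra.
Require Import Defs.

(** * Derivatives relative to a closed interval *)

Definition clamp (a b u : R) : R := Rmax a (Rmin b u).

Lemma clamp_id (a b u : R) : a <= u <= b -> clamp a b u = u.
Proof.
intros [Hau Hub]. unfold clamp. rewrite Rmin_right, Rmax_right; lra.
Qed.

Lemma clamp_bounds (a b u : R) : a <= b -> a <= clamp a b u <= b.
Proof.
intros Hab. unfold clamp, Rmax, Rmin.
destruct (Rle_dec b u); destruct (Rle_dec a _); lra.
Qed.

Lemma clamp_lipschitz (a b u w : R) :
  Rabs (clamp a b u - clamp a b w) <= Rabs (u - w).
Proof.
unfold clamp, Rmax, Rmin, Rabs.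
repeat destruct (Rle_dec _ _); repeat destruct (Rcase_abs _); lra.
Qed.

Lemma continuity_pt_clamp (f : R -> R) (a b t : R) :
  a <= t <= b -> continue_in f (fun u => a <= u <= b) t ->
  continuity_pt (fun u => f (clamp a b u)) t.
Proof.
intros Ht Hf eps Heps.
destruct (Hf eps Heps) as [delta [Hdelta Hlim]].
exists delta. split; [exact Hdelta|].
intros u [_ Hu]. simpl in *. unfold Rdist in *.
rewrite (clamp_id a b t Ht).
(* [continue_in] excludes the base point from its limit, and [clamp] may send [u] onto [t], so that
   case is separate. *)
destruct (Req_dec t (clamp a b u)) as [Heq|Hneq].
- rewrite <- Heq, Rminus_diag, Rabs_R0. exact Heps.
- apply Hlim. split.
  + split; [apply clamp_bounds; lra|exact Hneq].
  + pose proof (clamp_lipschitz a b u t) as Hlip.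
    rewrite (clamp_id a b t Ht) in Hlip. lra.
Qed.

Lemma derivable_pt_lim_clamp (f df : R -> R) (a b t : R) :
  a < t < b -> D_in f df (fun u => a <= u <= b) t ->
  derivable_pt_lim (fun u => f (clamp a b u)) t (df t).
Proof.
intros Ht Hf eps Heps.
destruct (Hf eps Heps) as [delta [Hdelta Hlim]].
assert (Hpos : 0 < Rmin delta (Rmin (t - a) (b - t))).
{ repeat apply Rmin_pos; lra. }
exists (mkposreal _ Hpos). simpl. intros h Hh0 Hh.
pose proof (Rmin_l delta (Rmin (t - a) (b - t))).
pose proof (Rmin_r delta (Rmin (t - a) (b - t))).
pose proof (Rmin_l (t - a) (b - t)).
pose proof (Rmin_r (t - a) (b - t)).
assert (Hin : a <= t + h <= b).
{ assert (Hb : Rabs h < Rmin (t - a) (b - t)) by lra.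
  apply Rabs_def2 in Hb. lra. }
rewrite !clamp_id by lra.
simpl in Hlim. unfold Rdist in Hlim.
specialize (Hlim (t + h)).
replace (t + h - t) with h in Hlim by ring.
apply Hlim. split; [split; [exact Hin|lra]|lra].
Qed.

(* Composing with [clamp] turns the one-sided derivatives at the endpoints
   into ordinary continuity, as [null_derivative_loc] requires. *)
Lemma D_in_zero_constant (f : R -> R) (a b : R) :
  (forall t, a <= t <= b ->
     D_in f (fun _ => 0) (fun u => a <= u <= b) t) ->
  forall t, a <= t <= b -> f t = f a.
Proof.
intros Hf t Ht.
assert (Hder : forall u, a < u < b ->
          derivable_pt_lim (fun w => f (clamp a b w)) u 0).
{ intros u Hu.
  apply (derivable_pt_lim_clamp f (fun _ => 0)); [exact Hu|].
  apply Hf; lra. }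
pose (pr := fun u Hu => exist _ 0 (Hder u Hu)
        : derivable_pt (fun w => f (clamp a b w)) u).
assert (Hcst := null_derivative_loc (fun w => f (clamp a b w)) a b pr).
rewrite <- (clamp_id a b t Ht).
rewrite <- (clamp_id a b a) at 2 by lra.
apply Hcst; [| reflexivity | exact Ht].
intros u Hu. apply continuity_pt_clamp; [exact Hu|].
apply (cont_deriv f (fun _ => 0)). apply Hf, Hu.
Qed.

(** [f - g] has zero derivative relative to the interval. An explicit [g] thus determines [f], with
    no appeal to a uniqueness theorem for differential equations. *)
Lemma D_in_unique_increment (f g df dg : R -> R) (a b : R) :
  (forall t, a <= t <= b -> D_in f df (fun u => a <= u <= b) t) ->
  (forall t, a <= t <= b -> derivable_pt_lim g t (dg t)) ->
  (forall t, a <= t <= b -> df t = dg t) ->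
  forall t, a <= t <= b -> f t - f a = g t - g a.
Proof.
intros Hf Hg Heq t Ht.
enough (f t - g t = f a - g a) by lra.
apply (D_in_zero_constant (fun u => f u - g u) a b); [|exact Ht].
intros u Hu.
assert (Hgu : D_in g dg (fun w => a <= w <= b) u).
{ apply (D_in_imp _ _ no_cond); [intros; exact I|].
  apply derivable_pt_lim_D_in, Hg, Hu. }
assert (H := Dminus _ _ _ _ _ _ (Hf u Hu) Hgu).
unfold D_in in *. rewrite (Heq u Hu), Rminus_diag in H. exact H.
Qed.

Lemma constant_acceleration (p w : R -> R) (acc d : R) :
  (forall t, 0 <= t <= d -> D_in p w (fun u => 0 <= u <= d) t) ->
  (forall t, 0 <= t <= d ->
     D_in w (fun _ => acc) (fun u => 0 <= u <= d) t) ->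
  forall t, 0 <= t <= d ->
    w t = w 0 + acc * t /\ p t = p 0 + w 0 * t + acc * t ^ 2 / 2.
Proof.
intros Hp Hw.
assert (Hvel : forall t, 0 <= t <= d -> w t = w 0 + acc * t).
{ intros t Ht.
  assert (H := D_in_unique_increment w (fun u => acc * u)
                 (fun _ => acc) (fun _ => acc * 1) 0 d Hw).
  rewrite Rmult_0_r in H.
  enough (w t - w 0 = acc * t - 0) by lra.
  apply H; [|intros; ring|exact Ht].
  intros u _. apply (derivable_pt_lim_scal id), derivable_pt_lim_id. }
intros t Ht. split; [apply Hvel, Ht|].
assert (H := D_in_unique_increment p
               (fun u => w 0 * u + acc / 2 * u ^ 2)
               w (fun u => w 0 * 1 + acc / 2 * (INR 2 * u ^ 1)) 0 d Hp).
enough (p t - p 0 = w 0 * t + acc / 2 * t ^ 2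
                    - (w 0 * 0 + acc / 2 * 0 ^ 2)) by lra.
apply H; [| |exact Ht].
- intros u _.
  apply (derivable_pt_lim_plus (fun u => w 0 * u)
           (fun u => acc / 2 * u ^ 2)).
  + apply (derivable_pt_lim_scal id), derivable_pt_lim_id.
  + apply (derivable_pt_lim_scal (fun u => u ^ 2)),
      (derivable_pt_lim_pow u 2).
- intros u Hu. rewrite (Hvel u Hu). simpl. field.
Qed.

(** * Monotonicity of the reach *)

(* Distance travelled up to time [t] plus braking distance from there: [msd(0)]
   at [t = 0], and the first case of [msd(T)] at [t = T]. *)
Definition reach (B v a t : R) : R :=
  v * t + a * t ^ 2 / 2 + (v + a * t) ^ 2 / (2 * B).

(** The distance covered is the elapsed time times the mean velocity, and the braking distance
    changes by [a / B] times that; hence the factor [B + a], which decides the sign. *)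
Lemma reach_diff (B v a t t' : R) : B <> 0 ->
  reach B v a t' - reach B v a t =
  (t' - t) * ((v + a * t) + (v + a * t')) * (B + a) / (2 * B).
Proof. intros HB. unfold reach. field. exact HB. Qed.

Lemma reach_mono (B v a t t' : R) :
  0 < B -> - B <= a -> t <= t' -> 0 <= v + a * t -> 0 <= v + a * t' ->
  reach B v a t <= reach B v a t'.
Proof.
intros HB Ha Ht Hv Hv'.
enough (0 <= reach B v a t' - reach B v a t) by lra.
rewrite reach_diff by lra.
apply Rmult_le_pos; [|apply Rlt_le, Rinv_0_lt_compat; lra].
repeat apply Rmult_le_pos; lra.
Qed.

Lemma reach_anti (B v a t t' : R) :
  0 < B -> a <= - B -> t <= t' -> 0 <= v + a * t -> 0 <= v + a * t' ->
  reach B v a t' <= reach B v a t.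
Proof.
intros HB Ha Ht Hv Hv'.
enough (0 <= - (reach B v a t' - reach B v a t)) by lra.
rewrite reach_diff by lra. unfold Rdiv.
replace (- ((t' - t) * (v + a * t + (v + a * t')) * (B + a) * / (2 * B)))
  with ((t' - t) * (v + a * t + (v + a * t')) * (- (B + a)) * / (2 * B))
  by ring.
apply Rmult_le_pos; [|apply Rlt_le, Rinv_0_lt_compat; lra].
repeat apply Rmult_le_pos; lra.
Qed.

Lemma reach_0 (B v a : R) : reach B v a 0 = v ^ 2 / (2 * B).
Proof.
unfold reach. rewrite !Rmult_0_r, Rplus_0_r.
replace (a * 0 ^ 2 / 2) with 0 by field. ring.
Qed.

(** At the stopping time [- v / a] the braking term vanishes, so [B] drops out. *)
Lemma reach_stop (B v a : R) : B <> 0 -> a <> 0 ->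
  reach B v a (- v / a) = - (v ^ 2 / (2 * a)).
Proof. intros HB Ha. unfold reach. field. split; assumption. Qed.

Lemma reach_le_msd (s : state) (t : R) :
  0 < s Pasmin -> 0 <= s Vv -> 0 <= t <= s PT ->
  0 <= s Vv + s Van * t ->
  reach (s Pasmin) (s Vv) (s Van) t <= Rmax (msd_0 s) (msd_T s).
Proof.
intros HB Hv Ht Hvt.
destruct (Rle_dec (s Van) (- s Pasmin)) as [Ha|Ha].
- apply Rle_trans with (msd_0 s); [|apply Rmax_l].
  unfold msd_0. rewrite <- (reach_0 _ _ (s Van)).
  apply reach_anti; lra.
- apply Rle_trans with (msd_T s); [|apply Rmax_r].
  unfold msd_T.
  destruct (Rle_dec 0 (s Vv + s Van * s PT)) as [HT|HT].
  + apply reach_mono; lra.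
  + assert (Hneg : s Van < 0) by nra.
    (* The velocity would be negative at time [T], so the comparison is made with the stopping time
       instead. *)
    rewrite <- (reach_stop (s Pasmin)) by lra.
    assert (Hstop : s Van * (- s Vv / s Van) = - s Vv) by (field; lra).
    apply reach_mono; try lra.
    (* Multiplied by [- s Van > 0], the claim that [t] does not exceed the stopping time becomes
       [0 <= s Vv + s Van * t]. *)
    apply Rmult_le_reg_l with (- s Van); lra.
Qed.

(** * Preservation of the loop invariant *)

Definition safe (s : state) : Prop :=
  0 < s Pasmin /\ 0 <= s Vv /\ s Vxc - s Vx >= msd_0 s.

Lemma env_safe (s s' : state) : safe s -> rho env s s' -> safe s'.
Proof.
intros (HB & Hv & _) (s1 & [xc ->] & s2 & [-> Hsafe] & s3 & [an ->] & -> & _).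
(* [msd_0] does not mention [Van], so the test on the new [Vxc] survives the later choice of
   [Van]. *)
exact (conj HB (conj Hv Hsafe)).
Qed.

(** The contract handed to the plant: whenever it stops within [T] at nonnegative velocity, there is
    still room to brake. *)
Lemma ctrl_reach (s s' : state) : safe s -> rho ctrl s s' ->
  safe s' /\
  forall t, 0 <= t <= s' PT -> 0 <= s' Vv + s' Vas * t ->
    reach (s' Pasmin) (s' Vv) (s' Vas) t <= s' Vxc - s' Vx.
Proof.
intros Hs Hctrl. pose proof Hs as (HB & Hv & Hd).
destruct Hctrl as [(s1 & [-> Hfar] & ->) | (s1 & [-> _] & ->)];
  (split; [exact Hs|]); intros t Ht Hvt.
- apply Rle_trans with (Rmax (msd_0 s) (msd_T s)).
  + apply (reach_le_msd s t); assumption.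
  (* [msd_0] is bounded by the invariant, [msd_T] by the controller's test. *)
  + apply Rmax_lub; cbn; apply Rge_le; assumption.
- apply Rle_trans with (msd_0 s); [|apply Rge_le, Hd].
  cbn in *. unfold msd_0. rewrite <- (reach_0 _ _ (- s Pasmin)).
  apply reach_anti; lra.
Qed.

Lemma plant_safe (s s' : state) : safe s ->
  (forall t, 0 <= t <= s PT -> 0 <= s Vv + s Vas * t ->
     reach (s Pasmin) (s Vv) (s Vas) t <= s Vxc - s Vx) ->
  rho plant s s' -> safe s'.
Proof.
intros (HB & _ & _) Hreach (s1 & Hs1 & d & phi & Hd & (Hode & Hfix & HQ) & H0 & <-).
assert (Hdd : 0 <= d <= d) by lra.
assert (Hacc : forall t, 0 <= t <= d -> phi t Vas = s Vas).
{ intros t Ht. rewrite (Hfix Vas) by (trivial; simpl; intuition discriminate).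
  rewrite H0, Hs1. reflexivity. }
destruct (constant_acceleration (fun u => phi u Vx) (fun u => phi u Vv)
            (s Vas) d) with (t := d) as [Hv Hx]; [| |exact Hdd|].
{ intros t Ht. apply (Hode Vx (fun s => s Vv)); [simpl; tauto|exact Ht]. }
{ intros t Ht.
  assert (H := Hode Vv (fun s => s Vas) ltac:(simpl; tauto) t Ht).
  unfold D_in in *. rewrite (Hacc t Ht) in H. exact H. }
(* The clock starts at 0, so it reads [d] at the end and the evolution domain gives [d <= T]. *)
assert (Htau : phi d Vtau - phi 0 Vtau = d - 0).
{ apply (D_in_unique_increment (fun u => phi u Vtau) (fun u => u)
           (fun _ => 1) (fun _ => 1) 0 d); [| |reflexivity|exact Hdd].
  - intros t Ht. apply (Hode Vtau (fun _ => 1)); [simpl; tauto|exact Ht].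
  - intros t _. apply derivable_pt_lim_id. }
destruct (HQ d Hdd) as [Hvd HT].
assert (HBd : phi d Pasmin = s Pasmin).
{ rewrite Hfix by (trivial; simpl; intuition discriminate).
  rewrite H0, Hs1. reflexivity. }
assert (Hxc : phi d Vxc = s Vxc).
{ rewrite Hfix by (trivial; simpl; intuition discriminate).
  rewrite H0, Hs1. reflexivity. }
assert (HTd : phi d PT = s PT).
{ rewrite Hfix by (trivial; simpl; intuition discriminate).
  rewrite H0, Hs1. reflexivity. }
rewrite H0, Hs1 in Hv, Hx, Htau. cbn in Hv, Hx, Htau.
rewrite HTd in HT.
assert (Hr := Hreach d ltac:(lra) ltac:(lra)).
unfold safe, msd_0. rewrite HBd, Hxc, Hx, Hv.
unfold reach in Hr. repeat split; lra.
Qed.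

Lemma safe_guarantee (s : state) : safe s -> guarantee s.
Proof.
intros (HB & Hv & Hd) Hx. unfold msd_0 in Hd.
(* Past [Vxc] the braking distance is at most 0; clearing its denominator forces the square of the
   velocity to be 0. *)
assert (Hsq : s Vv ^ 2 = s Vv ^ 2 / (2 * s Pasmin) * (2 * s Pasmin))
  by (field; lra).
nra.
Qed.

Theorem theorem3 :
  valid (Imp init (Box (Star (Seq env (Seq ctrl plant))) guarantee)).
Proof.
intros s (HB & _ & _ & _ & Hv & Hd) s' Hrun.
apply safe_guarantee.
assert (Hs : safe s) by (split; [|split]; [lra|lra|exact Hd]).
clear HB Hv Hd.
induction Hrun as [s s' (s1 & Henv & s2 & Hctrl & Hplant) | | ]; auto.
destruct (ctrl_reach s1 s2 (env_safe _ _ Hs Henv) Hctrl) as [Hs2 Hreach].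
exact (plant_safe _ _ Hs2 Hreach Hplant).
Qed.
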